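(* Let $p,q,r$ be the polynomials $$p(\lambda)=1-\lambda,\qquad q(\lambda)=1+\lambda p(\lambda),\qquad r(\lambda)=p(\lambda)-\lambda q(\lambda).$$ Let $q_1<q_2$ and $r_1<r_2<r_3$ be the roots of $q$ and $r$, respectively. For every $\alpha>0$, the spectrum of $\mathcal{B}_\alpha\mathcal{A}_\alpha$ is contained within three intervals, determined by the roots of $p$, $q$ and $r$ independently of $\alpha$: $$\operatorname{sp}(\mathcal{B}_\alpha\mathcal{A}_\alpha)\subset[r_1,q_1]\cup[r_2,1]\cup[q_2,r_3].$$ Consequently, the spectral condition number of $\mathcal{B}_\alpha\mathcal{A}_\alpha$ is bounded, uniformly in $\alpha$: $$k(\mathcal{B}_\alpha\mathcal{A}_\alpha)\le\frac{r_3}{r_2}\approx4.049 .$$ If $K$ has a nontrivial kernel, the inequality $k(\mathcal{B}_\alpha\mathcal{A}_\alpha)\le r_3/r_2$ becomes an equality.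
   Context: $U$ and $W$ are real finite-dimensional Hilbert spaces (the operators $\mathcal{A}_\alpha$ and $\mathcal{B}_\alpha$ are assumed finite-dimensional), with dual spaces $U'$, $W'$; primes on operators denote dual operators. $A:U\to W'$, $M:W\to W'$ and $K:U\to U'$ are linear operators, and $R:U\to U'$ is defined by $R=A'M^{-1}A$. Assume: $M$ is self-adjoint and positive definite; $K+R$ is positive definite; $K$ is self-adjoint and positive semi-definite. For $\alpha>0$, define the self-adjoint operators on $W\times U\times W$ (with values in $W'\times U'\times W'$) $$\mathcal{A}_\alpha=\begin{bmatrix}\alpha M&0&M'\\ 0&K&A'\\ M&A&0\end{bmatrix},\qquad\mathcal{B}_\alpha^{-1}=\begin{bmatrix}\alpha M&0&0\\ 0&K+\alpha R&0\\ 0&0&\alpha^{-1}M\end{bmatrix}.$$ $\operatorname{sp}$ denotes the spectrum, and the spectral condition number $k(\mathcal{B}_\alpha\mathcal{A}_\alpha)$ is the ratio of the largest to the smallest absolute value of the eigenvalues of $\mathcal{B}_\alpha\mathcal{A}_\alpha$. *)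

(* Defs.v *)
From HB Require Import structures.
From mathcomp Require Import all_boot all_order all_algebra.
From mathcomp Require Import complex.
From mathcomp Require Import classical_sets reals.

Set Implicit Arguments.
Unset Strict Implicit.
Unset Printing Implicit Defensive.

Import Order.TTheory GRing.Theory Num.Theory.
Local Open Scope ring_scope.

(* In finite dimension every linear functional is bounded, so the dual of a
   Hilbert space V is the space 'Hom(V, R^o) of all linear functionals, and the
   inner product of V itself is never used: the duality pairing of
   phi : 'Hom(V, R^o) with v is the application phi v. *)

(* The dual of F : V -> W', where W is identified with its bidual, so that it
   maps W to V' (rather than W'' to V'). *)
Definition dual_op (R : fieldType) (V W : vectType R)
    (F : 'Hom(V, 'Hom(W, R^o))) : 'Hom(W, 'Hom(V, R^o)) :=
  linfun (fun w : W => linfun (fun v : V => F v w : R^o)).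

Definition self_adjoint (R : fieldType) (V : vectType R)
    (F : 'Hom(V, 'Hom(V, R^o))) : Prop :=
  dual_op F = F.

Definition positive_definite (R : realFieldType) (V : vectType R)
    (F : 'Hom(V, 'Hom(V, R^o))) : Prop :=
  forall v : V, v != 0 -> 0 < (F v v : R).

Definition positive_semidefinite (R : realFieldType) (V : vectType R)
    (F : 'Hom(V, 'Hom(V, R^o))) : Prop :=
  forall v : V, 0 <= (F v v : R).

(* Below, ^-1 on linear maps is the inverse when the map is bijective (in
   general it is only a generalized inverse). *)

Definition opR (R : fieldType) (U W : vectType R)
    (A : 'Hom(U, 'Hom(W, R^o))) (M : 'Hom(W, 'Hom(W, R^o))) :
    'Hom(U, 'Hom(U, R^o)) :=
  (dual_op A \o M^-1 \o A)%VF.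

Section Operators.
Variables (R : fieldType) (U W : vectType R).
Variables (A : 'Hom(U, 'Hom(W, R^o))) (M : 'Hom(W, 'Hom(W, R^o))).
Variables (K : 'Hom(U, 'Hom(U, R^o))) (alpha : R).

(* A vector (f, u, w) of W * U * W is x with f = x.1.1, u = x.1.2, w = x.2. *)

Definition opA_fun (x : (W * U * W)%type) :
    ('Hom(W, R^o) * 'Hom(U, R^o) * 'Hom(W, R^o))%type :=
  (alpha *: M x.1.1 + dual_op M x.2,
   K x.1.2 + dual_op A x.2,
   M x.1.1 + A x.1.2).

Definition opA :
    'Hom((W * U * W)%type, ('Hom(W, R^o) * 'Hom(U, R^o) * 'Hom(W, R^o))%type) :=
  linfun opA_fun.

Definition opBinv_fun (x : (W * U * W)%type) :
    ('Hom(W, R^o) * 'Hom(U, R^o) * 'Hom(W, R^o))%type :=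
  (alpha *: M x.1.1,
   K x.1.2 + alpha *: opR A M x.1.2,
   alpha^-1 *: M x.2).

Definition opBinv :
    'Hom((W * U * W)%type, ('Hom(W, R^o) * 'Hom(U, R^o) * 'Hom(W, R^o))%type) :=
  linfun opBinv_fun.

Definition opB :
    'Hom(('Hom(W, R^o) * 'Hom(U, R^o) * 'Hom(W, R^o))%type, (W * U * W)%type) :=
  (opBinv^-1)%VF.

Lemma dual_opE (V1 V2 : vectType R) (F : 'Hom(V1, 'Hom(V2, R^o))) w v :
  dual_op F w v = F v w.
Proof.
have Hin w1 : linear (fun v : V1 => F v w1 : R^o).
  by move=> a x y; rewrite linearP !lfunE /= lfunE.
pose fin w1 : {linear V1 -> R^o} :=
  HB.pack (fun v : V1 => F v w1 : R^o) (GRing.isLinear.Build _ _ _ _ _ (Hin w1)).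
have HinE w1 x : linfun (fun v : V1 => F v w1 : R^o) x = F x w1.
  exact: (lfunE (fin w1)).
have Hout : linear (fun w : V2 => linfun (fun v : V1 => F v w : R^o)).
  move=> a x y; apply/lfunP => z.
  by rewrite !lfunE /= lfunE /= !HinE linearP.
pose fout : {linear V2 -> 'Hom(V1, R^o)} :=
  HB.pack (fun w : V2 => linfun (fun v : V1 => F v w : R^o))
    (GRing.isLinear.Build _ _ _ _ _ Hout).
by rewrite (lfunE fout) /= HinE.
Qed.

Lemma opA_fun_linear : linear opA_fun.
Proof.
move=> a x y; congr (_, _, _); rewrite /= !linearP /= ?scalerDr ?scalerA.
- by rewrite (mulrC alpha) addrACA.
- by rewrite addrACA.
- by rewrite addrACA.
Qed.

HB.instance Definition _ :=
  GRing.isSemilinear.Build R (W * U * W)%type _ _ opA_fun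
    (GRing.semilinear_linear opA_fun_linear).

Lemma opAE x : opA x = opA_fun x.
Proof. exact: lfunE. Qed.

Lemma opBinv_fun_linear : linear opBinv_fun.
Proof.
move=> a x y; congr (_, _, _); rewrite /= !linearP /= ?scalerDr ?scalerA.
- by [].
- by rewrite addrACA.
- by [].
Qed.

HB.instance Definition _ :=
  GRing.isSemilinear.Build R (W * U * W)%type _ _ opBinv_fun
    (GRing.semilinear_linear opBinv_fun_linear).

Lemma opBinvE x : opBinv x = opBinv_fun x.
Proof. exact: lfunE. Qed.

End Operators.

(* The spectrum of an endomorphism of a real space is the set of complex
   eigenvalues of its complexification, here read off its matrix in a basis. *)
Definition spectrum (R : rcfType) (V : vectType R) (f : 'End(V)) : set R[i] :=
  [set z : R[i] | eigenvalue
     (map_mx (real_complex R) (passmx.mxof (vbasis {:V}) (vbasis {:V}) f)) z].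

Definition spectral_moduli (R : rcfType) (V : vectType R) (f : 'End(V)) :
    set R :=
  [set complex.Re `|z| | z in spectrum f].

(* The spectrum is finite, so sup and inf are the maximum and the minimum of
   the moduli whenever V is nonzero; if V = 0 then the value is 0. *)
Definition spectral_cond (R : realType) (V : vectType R) (f : 'End(V)) : R :=
  sup (spectral_moduli f) / inf (spectral_moduli f).

Definition poly_p (R : realType) : {poly R} := 1 - 'X.
Definition poly_q (R : realType) : {poly R} := 1 + 'X * poly_p R.
Definition poly_r (R : realType) : {poly R} := poly_p R - 'X * poly_q R.

(* Main.v *)
(** An eigenvector (f, u, w) of B A for l solves A x = l B^-1 x.  Since B^-1 is
    symmetric positive definite and A symmetric, l is real.  The first and third
    rows give w = - alpha p f and A u = - q M f; if q(l) != 0, then u != 0 and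
    testing the second row with u yields
      p q <K u, u> + alpha r <R u, u> = 0,
    where both forms are nonnegative with positive sum.  Hence p q r <= 0 at l;
    pairing the six roots as (r1, q1), (r2, 1), (q2, r3) shows that p q r > 0
    outside the three intervals (and the roots of q lie inside them).  If
    K u = 0 for some u != 0, then each root of r is an eigenvalue, so that the
    extreme moduli r2 and r3 are attained. *)

Require Import Defs.
From mathcomp Require Import all_boot all_order all_algebra.
From mathcomp Require Import complex.
From mathcomp Require Import classical_sets reals.
From mathcomp Require Import ring lra.

Set Implicit Arguments.
Unset Strict Implicit.
Unset Printing Implicit Defensive.

Import Order.TTheory GRing.Theory Num.Theory.
Local Open Scope classical_set_scope.
Local Open Scope ring_scope.

(** * Complex eigenvalues of a real endomorphism *)

Section Spectrum.
Variables (R : rcfType) (V : vectType R).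
Implicit Types (f : 'End(V)) (z : R[i]).

Lemma real_eigenvalue_spectrum f (l : R) (x : V) :
  x != 0 -> f x = l *: x -> spectrum f (real_complex R l).
Proof.
move=> x0 fx; set e := vbasis {:V}; have eP : basis_of {:V} e := vbasisP _.
apply/eigenvalueP; exists (map_mx (real_complex R) (passmx.rVof e x)).
  rewrite -map_mxM -passmx.rVof_app // fx -map_mxZ; congr map_mx.
  by apply/rowP => i; rewrite !mxE linearZ.
by rewrite map_mx_eq0 passmx.rVof_eq0.
Qed.

(** The matrix of [f] is real, so the eigenvector equation in coordinates splits into its real and
    imaginary parts. This replaces a complex eigenvector by two real vectors, on which the real
    bilinear forms can be evaluated. *)
Lemma spectrum_re_im f z : spectrum f z ->
  exists a b : V, [/\ (a != 0) || (b != 0),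
    f a = complex.Re z *: a - complex.Im z *: b &
    f b = complex.Re z *: b + complex.Im z *: a].
Proof.
set e := vbasis {:V}; have eP : basis_of {:V} e := vbasisP _.
move=> /eigenvalueP[v vz v0].
set N := passmx.mxof e e f in vz.
pose a := map_mx (@complex.Re R) v; pose b := map_mx (@complex.Im R) v.
exists (passmx.vecof e a), (passmx.vecof e b).
have aN : a *m N = complex.Re z *: a - complex.Im z *: b.
  transitivity (map_mx (@complex.Re R) (z *: v)).
    rewrite -vz; apply/matrixP => i j; rewrite !mxE (raddf_sum (@complex.Re R)).
    by apply: eq_bigr => k _; rewrite !mxE; case: (v i k) => x y /=; ring.
  by apply/matrixP => i j; rewrite !mxE; case: (z) (v i j) => [s t] [x y].
have bN : b *m N = complex.Re z *: b + complex.Im z *: a.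
  transitivity (map_mx (@complex.Im R) (z *: v)).
    rewrite -vz; apply/matrixP => i j; rewrite !mxE (raddf_sum (@complex.Im R)).
    by apply: eq_bigr => k _; rewrite !mxE; case: (v i k) => x y /=; ring.
  by apply/matrixP => i j; rewrite !mxE; case: (z) (v i j) => [s t] [x y].
have lin c d : passmx.vecof e (c *: a + d *: b) =
    c *: passmx.vecof e a + d *: passmx.vecof e b.
  rewrite /passmx.vecof !scaler_sumr -big_split; apply: eq_bigr => i _ /=.
  by rewrite !scalerA -scalerDl !mxE.
split.
- rewrite !passmx.vecof_eq0 // -negb_and.
  apply: contraNN v0 => /andP[/eqP/matrixP a0 /eqP/matrixP b0].
  apply/eqP/matrixP => i j; move: (a0 i j) (b0 i j); rewrite !mxE => re im.
  by apply/eqP; rewrite eq_complex re im !eqxx.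
- by rewrite (passmx.hom_vecof e eP) aN -!scaleNr lin.
- by rewrite (passmx.hom_vecof e eP) bN [in LHS]addrC lin addrC.
Qed.

End Spectrum.

(** * Inverses by dimension count, and the duality pairing *)

Lemma lker0_of_eq0 (R : fieldType) (V V' : vectType R) (f : 'Hom(V, V')) :
  (forall v, f v = 0 -> v = 0) -> lker f == 0%VS.
Proof.
move=> f_inj; rewrite -subv0; apply/subvP => v; rewrite memv_ker memv0 => /eqP fv.
by rewrite (f_inj v fv).
Qed.

Lemma eq_dim_lfunVK (R : fieldType) (V V' : vectType R) (f : 'Hom(V, V')) :
  lker f == 0%VS -> dim V = dim V' -> cancel f^-1%VF f.
Proof.
move=> kerf dimV y; apply: limg_lfunVK.
have -> : limg f = fullv; last exact: memvf.
apply/eqP; rewrite eqEdim subvf limg_dim_eq ?dimvf ?dimV //=.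
by rewrite (eqP kerf) capv0.
Qed.

Lemma dim_dual (R : fieldType) (V : vectType R) : dim 'Hom(V, R^o) = dim V.
Proof. exact: muln1. Qed.

(** The pairing turns [opA] and [opBinv] into bilinear forms on [W * U * W], so that one can speak
    of their symmetry and positivity. *)
Definition dual_pairing (R : fieldType) (U W : vectType R)
    (phi : 'Hom(W, R^o) * 'Hom(U, R^o) * 'Hom(W, R^o)) (x : W * U * W) : R :=
  phi.1.1 x.1.1 + phi.1.2 x.1.2 + phi.2 x.2.

(** * The symmetric pencil formed by [opA] and [opBinv] *)

Section Pencil.
Variables (R : realFieldType) (U W : vectType R).
Variables (A : 'Hom(U, 'Hom(W, R^o))) (M : 'Hom(W, 'Hom(W, R^o))).
Variables (K : 'Hom(U, 'Hom(U, R^o))).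
Hypotheses (M_sa : self_adjoint M) (M_pd : positive_definite M).
Hypotheses (KR_pd : positive_definite (K + opR A M)).
Hypotheses (K_sa : self_adjoint K) (K_psd : positive_semidefinite K).
Variable alpha : R.
Hypothesis alpha_gt0 : 0 < alpha.

Let MC x y : M x y = M y x. Proof. by rewrite -{1}M_sa dual_opE. Qed.
Let KC x y : K x y = K y x. Proof. by rewrite -{1}K_sa dual_opE. Qed.

Lemma posdef_eq0 (V : vectType R) (F : 'Hom(V, 'Hom(V, R^o))) v :
  positive_definite F -> F v v = 0 :> R -> v = 0.
Proof.
by move=> Fpd Fv; apply/eqP/contraT => /Fpd; rewrite Fv ltxx.
Qed.

Let M_ge0 x : 0 <= (M x x : R).
Proof.
have [->|/M_pd/ltW//] := eqVneq x 0.
by rewrite linear0.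
Qed.

Let M_inj x : M x = 0 -> x = 0.
Proof. by move=> Mx; apply: (posdef_eq0 M_pd); rewrite Mx lfunE. Qed.

Let Minv := (M^-1)%VF.
Let MVK : cancel Minv M.
Proof.
by apply: eq_dim_lfunVK; [exact: lker0_of_eq0 M_inj|rewrite dim_dual].
Qed.

(** The Riesz representative of [A u] for the inner product [M]. It expresses [A] and [opR A M]
    through [M] alone. *)
Let g u := Minv (A u).
Let AE u w : A u w = M (g u) w. Proof. by rewrite MVK. Qed.

Let opRE u v : opR A M u v = M (g u) (g v).
Proof. by rewrite /opR !comp_lfunE /= dual_opE AE MC. Qed.

Local Notation dpair := (@dual_pairing R U W).

Let dpair_opA x y : dpair (opA A M K alpha x) y =
  alpha * M x.1.1 y.1.1 + M x.2 y.1.1 + (K x.1.2 y.1.2 + M (g y.1.2) x.2)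
  + (M x.1.1 y.2 + M (g x.1.2) y.2).
Proof.
rewrite opAE /dual_pairing /= !(add_lfunE, scale_lfunE) /GRing.scale /= M_sa.
by rewrite !dual_opE !AE.
Qed.

Let dpair_opBinv x y : dpair (opBinv A M K alpha x) y =
  alpha * M x.1.1 y.1.1 + (K x.1.2 y.1.2 + alpha * M (g x.1.2) (g y.1.2))
  + alpha^-1 * M x.2 y.2.
Proof.
rewrite opBinvE /dual_pairing /= !(add_lfunE, scale_lfunE) /GRing.scale /=.
by rewrite opRE.
Qed.

Let dpair_opBinv_lin c d x y z : dpair (opBinv A M K alpha (c *: x + d *: y)) z =
  c * dpair (opBinv A M K alpha x) z + d * dpair (opBinv A M K alpha y) z.
Proof.
case: x y => [[x1 x2] x3] [[y1 y2] y3]; rewrite !dpair_opBinv /g /=.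
rewrite !(linearD, linearZ) /= !(add_lfunE, scale_lfunE) /GRing.scale /=.
ring.
Qed.

Lemma opA_symmetric x y :
  dpair (opA A M K alpha x) y = dpair (opA A M K alpha y) x.
Proof.
rewrite !dpair_opA (MC y.1.1 x.1.1) (KC y.1.2) (MC y.1.1 x.2) (MC x.1.1 y.2).
ring.
Qed.

Lemma opBinv_symmetric x y :
  dpair (opBinv A M K alpha x) y = dpair (opBinv A M K alpha y) x.
Proof.
by rewrite !dpair_opBinv (MC y.1.1) (KC y.1.2) (MC y.2) (MC (g y.1.2)).
Qed.

(** The hypothesis is the case [c = 1]. If the form of [opR A M] vanishes at [u], the weight is
    irrelevant; otherwise the weighted term is already positive and [K] only adds to it. *)
Lemma K_opR_gt0 (c : R) (u : U) : 0 < c -> u != 0 ->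
  0 < (K u u : R) + c * M (g u) (g u).
Proof.
move=> c0 u0; have := KR_pd u0; rewrite !add_lfunE opRE => KR.
have := K_psd u; have := M_ge0 (g u).
move: (K u u : R) (M _ _ : R) KR => k m /= km m0 k0.
have [mE|mN0] := eqVneq m 0; first by move: km; rewrite mE mulr0.
by rewrite ltr_wpDl // mulr_gt0 // lt_def mN0.
Qed.

(** The form is block diagonal with nonnegative blocks, so any one nonzero component of [x] makes it
    positive. *)
Lemma opBinv_gt0 x : x != 0 -> 0 < dpair (opBinv A M K alpha x) x.
Proof.
case: x => [[f u] w] x0; rewrite dpair_opBinv /=.
have aV0 : 0 < alpha^-1 by rewrite invr_gt0.
have f0 : 0 <= alpha * M f f by rewrite mulr_ge0 // ltW.
have w0 : 0 <= alpha^-1 * M w w by rewrite mulr_ge0 // ltW.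
have u0 : 0 <= (K u u : R) + alpha * M (g u) (g u).
  by rewrite addr_ge0 // mulr_ge0 // ltW.
have [fE|fN0] := eqVneq f 0; last first.
  have := mulr_gt0 alpha_gt0 (M_pd fN0); move: f0 w0 u0; lra.
have [uE|uN0] := eqVneq u 0; last first.
  have := K_opR_gt0 alpha_gt0 uN0; move: f0 w0 u0; lra.
have [wE|wN0] := eqVneq w 0; last first.
  have := mulr_gt0 aV0 (M_pd wN0); move: f0 w0 u0; lra.
by move: x0; rewrite fE uE wE eqxx.
Qed.

Lemma opBinv_ker0 : lker (opBinv A M K alpha) == 0%VS.
Proof.
rewrite -subv0; apply/subvP => x; rewrite memv_ker memv0 => /eqP Bx.
apply/contraT => /opBinv_gt0; rewrite Bx /dual_pairing /=.
by rewrite !zero_lfunE !addr0 ltxx.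
Qed.

(** [opB] is a priori only a generalized inverse. Positivity makes [opBinv] injective, and equality
    of dimensions makes it surjective as well. *)
Lemma opBK : cancel (opB A M K alpha) (opBinv A M K alpha).
Proof.
apply: (eq_dim_lfunVK opBinv_ker0).
exact/esym/(congr2 addn (congr2 addn (dim_dual W) (dim_dual U)) (dim_dual W)).
Qed.

Lemma opBinvK : cancel (opBinv A M K alpha) (opB A M K alpha).
Proof. exact: lker0_lfunK opBinv_ker0. Qed.

(** Pair the first equation with [b] and the second with [a]. By symmetry the left sides agree and
    the terms in [s] cancel, leaving [t] times the sum of the [opBinv] forms at [a] and [b], which
    is positive. *)
Lemma symmetric_pencil_real (s t : R) a b : (a != 0) || (b != 0) ->
  opA A M K alpha a = opBinv A M K alpha (s *: a - t *: b) ->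
  opA A M K alpha b = opBinv A M K alpha (s *: b + t *: a) -> t = 0.
Proof.
move=> ab Ha Hb; have := opA_symmetric a b.
rewrite Ha Hb -scaleNr !dpair_opBinv_lin.
rewrite (opBinv_symmetric b a).
set na := dpair (opBinv _ _ _ _ a) a; set nb := dpair (opBinv _ _ _ _ b) b.
have dpair_ge0 x : 0 <= dpair (opBinv A M K alpha x) x.
  have [->|/opBinv_gt0/ltW//] := eqVneq x 0.
  by rewrite linear0 /dual_pairing /= !zero_lfunE !addr0.
have nab : 0 < na + nb.
  case/orP: ab => /opBinv_gt0; rewrite -/na -/nb => n0.
    by rewrite ltr_wpDr //; exact: dpair_ge0.
  by rewrite ltr_wpDl //; exact: dpair_ge0.
move=> E; have /eqP : t * (na + nb) = 0 by move: E; lra.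
by rewrite mulf_eq0 (gt_eqF nab) orbF => /eqP.
Qed.

Lemma pencil_eigenvalue (l : R) x : x != 0 ->
  opA A M K alpha x = opBinv A M K alpha (l *: x) ->
  let p := 1 - l in let q := 1 + l * p in let r := p - l * q in
  q = 0 \/ exists k m : R,
    [/\ 0 <= k, 0 <= m, 0 < k + m & p * q * k + alpha * r * m = 0].
Proof.
case: x => [[f u] w] x0; rewrite opAE opBinvE => xE p q r.
case: xE; rewrite /= M_sa => e1 e2 e3.
(* Rows one and three are equations between values of [M]; its injectivity turns them into relations
   between vectors of [W]. *)
have wE : w = - (alpha * p) *: f.
  apply/eqP; rewrite -subr_eq0; apply/eqP/M_inj.
  move: e1; rewrite linearZ /= scalerA => /(canRL (addKr _)) Mw.
  rewrite linearB linearZ /= Mw -!scaleNr -!scalerDl -[RHS](scale0r (M f)).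
  by congr (_ *: _); rewrite /p; ring.
have gE : g u = - q *: f.
  move: e3; rewrite wE !linearZ /= !scalerA => /(canRL (addKr _)) Au.
  apply/eqP; rewrite -subr_eq0; apply/eqP/M_inj.
  rewrite linearB linearZ /= [M (g u)]MVK Au -[X in - X]scale1r -!scaleNr -!scalerDl.
  rewrite -[RHS](scale0r (M f)); congr (_ *: _); rewrite /q; field.
  exact: lt0r_neq0.
have [|qN0] := eqVneq q 0; [by left|right].
(* Now [u] determines [f], and hence [w], so [u = 0] would give [x = 0]. *)
have fE : f = - q^-1 *: g u by rewrite gE scalerA mulrNN mulVf // scale1r.
have uN0 : u != 0.
  by apply: contraNneq x0 => uE; rewrite wE fE uE /g !linear0 eqxx.
exists (K u u), (M (g u) (g u)); split => //.
- by have := K_opR_gt0 ltr01 uN0; rewrite mul1r.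
have := congr1 (fun phi : 'Hom(U, R^o) => phi u : R) e2.
rewrite /= !(add_lfunE, scale_lfunE) /GRing.scale /= dual_opE AE opRE.
rewrite wE fE /g !linearZ /= !(scale_lfunE) /GRing.scale /= -/(g u).
move: (K u u : R) (M _ _ : R) => k m E.
(* The tested second row, multiplied by [q] to clear the denominator; [p - l * q] collects into
   [r]. *)
have -> : p * q * k + alpha * r * m =
    q * (k + - (alpha * p) * (- q^-1 * m) - (l * k + alpha * (l * m))).
  by rewrite /r; move: (q) qN0 => c c0; rewrite /p; field.
by rewrite E subrr mulr0.
Qed.

(** For [u] in the kernel of [K], solving rows one and three as before reduces the second row to
    [p = l * q] times a common vector, which is exactly the vanishing of [r] at [l]. *)
Lemma eigenvalue_of_ker (l : R) : lker K != 0%VS ->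
  (1 - l) - l * (1 + l * (1 - l)) = 0 ->
  exists2 x, x != 0 & opA A M K alpha x = opBinv A M K alpha (l *: x).
Proof.
move=> kerK; set p := 1 - l; set q := 1 + l * p => rl.
pose u := vpick (lker K).
have u0 : u != 0 by rewrite vpick0.
have Ku : K u = 0 by apply/eqP; rewrite -memv_ker memv_pick.
(* A common root of [q] and [r] would be a root of [p], where [q] equals 1. This keeps the component
   [q *: u] of the witness nonzero. *)
have q0 : q != 0.
  apply/eqP => qE; move: rl; rewrite qE mulr0 subr0 => pE.
  by move/eqP: qE; rewrite /q pE mulr0 addr0 oner_eq0.
(* The eigenvector with f = - q^-1 M^-1 A u, scaled by q. *)
exists (- g u, q *: u, (alpha * p) *: g u).
  by apply/eqP => -[_ /eqP]; rewrite scaler_eq0 (negPf q0) (negPf u0).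
have opRu : dual_op A (g u) = opR A M u by rewrite /opR !comp_lfunE.
rewrite opAE opBinvE; congr (_, _, _) => /=.
- rewrite M_sa scalerN !linearN !linearZ /= !linearN /= -!scaleNr !scalerA -scalerDl.
  by congr (_ *: _); rewrite /p; ring.
- rewrite !linearZ /= Ku !scaler0 !add0r opRu !scalerA; congr (_ *: _).
  by move/eqP: rl; rewrite subr_eq0 => /eqP ->; ring.
- rewrite linearN !linearZ /= [A u](esym (MVK _)) -/(g u) -[X in - X]scale1r.
  rewrite -scaleNr -scalerDl !scalerA; congr (_ *: _); rewrite /q; field.
  exact: lt0r_neq0.
Qed.

End Pencil.

(** * Condition number from bounds on the moduli *)

Section ConditionNumber.
Variables (R : realType) (V : vectType R) (f : 'End(V)) (m M : R).
Hypotheses (m_gt0 : 0 < m) (M_ge0 : 0 <= M).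
Hypothesis bounds : forall z, spectrum f z -> m <= complex.Re `|z| <= M.

Let lb : lbound (spectral_moduli f) m.
Proof. by move=> _ [z /bounds/andP[]] ? ? <-. Qed.

Let ub : ubound (spectral_moduli f) M.
Proof. by move=> _ [z /bounds/andP[]] ? ? <-. Qed.

Lemma spectral_cond_le : spectral_cond f <= M / m.
Proof.
(* With no eigenvalue at all, the supremum is 0 by convention and so is the quotient. *)
rewrite /spectral_cond; have [->|ne] := eqVneq (spectral_moduli f) set0.
  by rewrite sup0 mul0r divr_ge0 // ltW.
have {}ne : spectral_moduli f !=set0 by apply/set0P.
have m_inf : m <= inf (spectral_moduli f) by exact: lb_le_inf.
have inf0 : 0 < inf (spectral_moduli f) := lt_le_trans m_gt0 m_inf.
rewrite ler_pM ?invr_ge0 ?(ltW inf0) // ?ge_sup // ?lef_pV2 //.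
case: ne => x Sx; apply: (@le_trans _ _ x).
  exact: le_trans (ltW m_gt0) (lb Sx).
by apply: ub_le_sup => //; exists M.
Qed.

Lemma spectral_cond_eq : spectral_moduli f m -> spectral_moduli f M ->
  spectral_cond f = M / m.
Proof.
move=> Sm SM; congr (_ / _); apply/le_anti/andP; split.
- by apply: ge_sup => //; exists M.
- by apply: ub_le_sup => //; exists M.
- by apply: ge_inf => //; exists m.
- by apply: lb_le_inf => //; exists m.
Qed.

End ConditionNumber.

(** * Location of the roots of [q] and [r] *)

Section Polynomials.
Variable R : realType.

(** Links the polynomials to the explicit scalar expressions produced by the pencil. *)
Lemma root_poly_q (x : R) : root (poly_q R) x = (1 + x * (1 - x) == 0).
Proof. by rewrite rootE /poly_q /poly_p !hornerE. Qed.

Lemma root_poly_r (x : R) :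
  root (poly_r R) x = ((1 - x) - x * (1 + x * (1 - x)) == 0).
Proof. by rewrite rootE /poly_r /poly_q /poly_p !hornerE. Qed.

(** The roots are the golden ratio and its conjugate. The rational brackets serve to order them
    against the roots of [r]. *)
Lemma poly_q_roots : exists q1 q2 : R,
  [/\ - (31%:R / 50%:R) < q1 < - (61%:R / 100%:R), 8%:R / 5%:R < q2 < 9%:R / 5%:R
    & forall x, 1 + x * (1 - x) = - ((x - q1) * (x - q2))].
Proof.
pose s := Num.sqrt (5%:R : R).
have ss : s * s = 5%:R by rewrite -expr2 sqr_sqrtr.
have s0 : 0 <= s := sqrtr_ge0 _.
exists ((1 - s) / 2%:R), ((1 + s) / 2%:R).
have lo : 111%:R / 50%:R < s by nra.
have hi : s < 112%:R / 50%:R by nra.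
split; [lra|lra|move=> x].
have -> : 1 + x * (1 - x) =
    - ((x - (1 - s) / 2%:R) * (x - (1 + s) / 2%:R)) + (5%:R - s * s) / 4%:R.
  by field.
by rewrite ss subrr mul0r addr0.
Qed.

(* The brackets are tight enough to locate r3 / r2 within 1/2000 of 4.049. *)
Lemma poly_r_roots : exists r1 r2 r3 : R,
  [/\ - (5%:R / 4%:R) < r1 < - (31%:R / 25%:R),
      89%:R / 200%:R < r2 < 81%:R / 182%:R,
      191%:R / 106%:R < r3 < 182%:R / 101%:R
    & forall x, (1 - x) - x * (1 + x * (1 - x)) = (x - r1) * (x - r2) * (x - r3)].
Proof.
pose c (x : R) := (1 - x) - x * (1 + x * (1 - x)).
(* Each bracket of the statement is a sign change of the cubic. *)
have ivt a b : a <= b -> c a * c b < 0 -> exists2 x, a < x < b & c x = 0.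
  have cE x : (poly_r R).[x] = c x by rewrite /poly_r /poly_q /poly_p !hornerE.
  move=> ab cab; have [|x xab] := @polyrcf.poly_ivtoo _ (poly_r R) _ _ ab.
    by rewrite !cE.
  by rewrite root_poly_r => /eqP cx; exists x.
have [||r1 r1_itv c1] := ivt (- (5%:R / 4%:R)) (- (31%:R / 25%:R)).
- lra.
- rewrite /c; lra.
have [||r2 r2_itv c2] := ivt (89%:R / 200%:R) (81%:R / 182%:R).
- lra.
- rewrite /c; lra.
have [||r3 r3_itv c3] := ivt (191%:R / 106%:R) (182%:R / 101%:R).
- lra.
- rewrite /c; lra.
exists r1, r2, r3; split => // x.
(* The divided difference of c. *)
pose e a b := a * a + a * b + b * b - (a + b) - 2%:R : R.
have cB a b : c a - c b = (a - b) * e a b by rewrite /c /e; ring.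
have e12 : e r1 r2 = 0.
  apply: (mulfI (_ : r1 - r2 != 0)); last by rewrite -cB c1 c2 mulr0 subrr.
  by apply/eqP; move: r1_itv r2_itv; lra.
have e32 : e r3 r2 = 0.
  apply: (mulfI (_ : r3 - r2 != 0)); last by rewrite -cB c3 c2 mulr0 subrr.
  by apply/eqP; move: r3_itv r2_itv; lra.
(* The sum of the roots is 1: the difference of [e12] and [e32] factors through [r3 - r1]. *)
have r3E : r3 = 1 - r1 - r2.
  apply/eqP; rewrite -subr_eq0; apply/eqP/(mulfI (_ : r3 - r1 != 0)).
    by apply/eqP; move: r3_itv r1_itv; lra.
  have -> : (r3 - r1) * (r3 - (1 - r1 - r2)) = e r3 r2 - e r1 r2 by rewrite /e; ring.
  by rewrite e12 e32 mulr0 subrr.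
(* Newton's interpolation form of the cubic at the nodes [r1] and [r2]. *)
have -> : (1 - x) - x * (1 + x * (1 - x)) =
    (x - r1) * (x - r2) * (x - (1 - r1 - r2)) + e r1 r2 * (x - r1) + c r1.
  by rewrite /c /e; ring.
by rewrite e12 c1 mul0r !addr0 r3E.
Qed.

End Polynomials.

(** * From the pencil to the spectrum of the preconditioned operator *)

Section PencilSpectrum.
Variables (R : rcfType) (U W : vectType R).
Variables (A : 'Hom(U, 'Hom(W, R^o))) (M : 'Hom(W, 'Hom(W, R^o))).
Variables (K : 'Hom(U, 'Hom(U, R^o))).
Hypotheses (M_sa : self_adjoint M) (M_pd : positive_definite M).
Hypotheses (KR_pd : positive_definite (K + opR A M)).
Hypotheses (K_sa : self_adjoint K) (K_psd : positive_semidefinite K).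
Variable alpha : R.
Hypothesis alpha_gt0 : 0 < alpha.
Local Notation BA := (opB A M K alpha \o opA A M K alpha)%VF.

(** Applying [opBinv] to the real and imaginary equations gives the pencil relations, which force a
    zero imaginary part. Either part of the eigenvector, if nonzero, is then a real eigenvector. *)
Lemma spectrum_pencil z : spectrum BA z ->
  z = real_complex R (complex.Re z) /\
  exists2 x, x != 0 & opA A M K alpha x = opBinv A M K alpha (complex.Re z *: x).
Proof.
have BK := opBK M_sa M_pd KR_pd K_psd alpha_gt0.
move=> /spectrum_re_im[a [b [ab]]]; rewrite !comp_lfunE => fa fb.
have Aa := BK (opA A M K alpha a); have Ab := BK (opA A M K alpha b).
have z0 : complex.Im z = 0.
  apply: (symmetric_pencil_real M_sa M_pd KR_pd K_sa K_psd alpha_gt0 ab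
    (s := complex.Re z)); first by rewrite -fa Aa.
  by rewrite -fb Ab.
split; first by case: z z0 {fa fb} => s t /= ->.
rewrite z0 !scale0r subr0 addr0 in fa fb.
by case/orP: ab => [a0|b0]; [exists a|exists b] => //; rewrite -?fa -?fb ?Aa ?Ab.
Qed.

Lemma pencil_spectrum (l : R) x : x != 0 ->
  opA A M K alpha x = opBinv A M K alpha (l *: x) -> spectrum BA (real_complex R l).
Proof.
move=> x0 Ax; apply: (real_eigenvalue_spectrum x0).
by rewrite comp_lfunE Ax (opBinvK M_sa M_pd KR_pd K_psd alpha_gt0).
Qed.

End PencilSpectrum.

(** * Sign argument and conclusion *)

Lemma Re_norm_real (R : rcfType) (x : R) : complex.Re `|real_complex R x| = `|x|.
Proof. by rewrite normc_def /= expr0n /= addr0 sqrtr_sqr. Qed.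

(** Multiplying the sum by [a] gives nonnegative coefficients [a ^+ 2] and [a * b], both in fact
    positive. *)
Lemma sum_same_sign_neq0 (R : realDomainType) (a b k m : R) :
  0 < a * b -> 0 <= k -> 0 <= m -> 0 < k + m -> a * k + b * m != 0.
Proof.
move=> ab k0 m0 km; apply/eqP => E.
have : a * (a * k + b * m) = a ^+ 2 * k + (a * b) * m by ring.
rewrite E mulr0; have a2 : 0 < a ^+ 2.
  by rewrite exprn_even_gt0 //=; apply: contraTneq ab => ->; rewrite mul0r ltxx.
have := mulr_ge0 (ltW a2) k0; have := mulr_ge0 (ltW ab) m0.
have [k1|kN0] := eqVneq k 0.
  have : 0 < (a * b) * m by rewrite mulr_gt0 //; move: km; rewrite k1 add0r.
  lra.
have : 0 < a ^+ 2 * k by rewrite mulr_gt0 // lt_def kN0.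
lra.
Qed.

Theorem theorem7p1 (R : realType) (U W : vectType R)
    (A : 'Hom(U, 'Hom(W, R^o))) (M : 'Hom(W, 'Hom(W, R^o)))
    (K : 'Hom(U, 'Hom(U, R^o)))
    (M_sa : self_adjoint M) (M_pd : positive_definite M)
    (KR_pd : positive_definite (K + opR A M))
    (K_sa : self_adjoint K) (K_psd : positive_semidefinite K) :
  exists q1 q2 r1 r2 r3 : R,
    [/\ q1 < q2, forall x : R, root (poly_q R) x = (x \in [:: q1; q2]),
        r1 < r2 < r3 & forall x : R, root (poly_r R) x = (x \in [:: r1; r2; r3])]
    /\ [/\ forall alpha : R, 0 < alpha ->
             spectrum (opB A M K alpha \o opA A M K alpha)%VF `<=`
               [set real_complex R x
                  | x in [set` `[r1, q1]] `|` [set` `[r2, 1]] `|` [set` `[q2, r3]]],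
           forall alpha : R, 0 < alpha ->
             spectral_cond (opB A M K alpha \o opA A M K alpha)%VF <= r3 / r2,
           `|r3 / r2 - 4049%:R / 1000%:R| < 1 / 2000%:R
         & lker K != 0%VS -> forall alpha : R, 0 < alpha ->
             spectral_cond (opB A M K alpha \o opA A M K alpha)%VF = r3 / r2].
Proof.
have [q1 [q2 [q1_itv q2_itv qE]]] := poly_q_roots R.
have [r1 [r2 [r3 [r1_itv r2_itv r3_itv rE]]]] := poly_r_roots R.
have out (a b x : R) : ~~ (x \in `[a, b]) -> a <= b -> 0 < (x - a) * (x - b).
  rewrite in_itv /= negb_and -!ltNge => /orP[xa|bx] ab.
    by rewrite nmulr_rgt0 subr_lt0 // (lt_le_trans xa).
  by rewrite pmulr_rgt0 subr_gt0 // (le_lt_trans ab).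
have spec (alpha : R) : 0 < alpha ->
    spectrum (opB A M K alpha \o opA A M K alpha)%VF `<=`
    [set real_complex R x
       | x in [set` `[r1, q1]] `|` [set` `[r2, 1]] `|` [set` `[q2, r3]]].
  move=> a0 z /(spectrum_pencil M_sa M_pd KR_pd K_sa K_psd a0)[zE [x x0 Ax]].
  exists (complex.Re z) => //; move: {zE} (complex.Re z) Ax => l Ax /=.
  have [l1|/out l1] := boolP (l \in `[r1, q1]); first by left; left.
  have [l2|/out l2] := boolP (l \in `[r2, 1]); first by left; right.
  have [l3|/out l3] := boolP (l \in `[q2, r3]); first by right.
  exfalso.
  have {}l1 : 0 < (l - r1) * (l - q1) by apply: l1; move: r1_itv q1_itv; lra.
  have {}l2 : 0 < (l - r2) * (l - 1) by apply: l2; move: r2_itv; lra.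
  have {}l3 : 0 < (l - q2) * (l - r3) by apply: l3; move: q2_itv r3_itv; lra.
  have [q0|[k [m [k0 m0 km]]]] := pencil_eigenvalue M_sa M_pd KR_pd K_psd a0 x0 Ax.
    (* A root of [q] is an endpoint of the first or third interval, which contradicts strict
       positivity of [l1] or [l3]. *)
    move/eqP: q0; rewrite qE oppr_eq0 mulf_eq0 => /orP[/eqP lE|/eqP lE].
      by move: l1; rewrite lE mulr0 ltxx.
    by move: l3; rewrite lE mul0r ltxx.
  rewrite rE qE; apply/eqP/sum_same_sign_neq0 => //.
  (* The two minus signs cancel, and the six linear factors regroup into one positive pair per
     interval. *)
  have -> : (1 - l) * - ((l - q1) * (l - q2)) *
      (alpha * ((l - r1) * (l - r2) * (l - r3))) =
    alpha * ((l - r1) * (l - q1) * ((l - r2) * (l - 1)) * ((l - q2) * (l - r3))).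
    by ring.
  exact: mulr_gt0 a0 (mulr_gt0 (mulr_gt0 l1 l2) l3).
have r20 : 0 < r2 by move: r2_itv; lra.
have r30 : 0 < r3 by move: r3_itv; lra.
(* On the negative interval the moduli lie between 0.61 and 1.25, hence strictly between [r2] and
   [r3]; the extremes come from the positive intervals. *)
have bounds (alpha : R) : 0 < alpha ->
    forall z, spectrum (opB A M K alpha \o opA A M K alpha)%VF z ->
    r2 <= complex.Re `|z| <= r3.
  move=> a0 z /(spec _ a0)[x xI <-]; rewrite Re_norm_real.
  move: xI; rewrite /= !in_itv /= => -[[/andP[xl xu]|/andP[xl xu]]|/andP[xl xu]].
  - rewrite ler0_norm; move: r1_itv q1_itv r2_itv r3_itv xl xu; lra.
  - rewrite ger0_norm; move: r2_itv r3_itv xl xu; lra.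
  - rewrite ger0_norm; move: q2_itv r2_itv r3_itv xl xu; lra.
exists q1, q2, r1, r2, r3; split; split.
- by move: q1_itv q2_itv; lra.
- by move=> x; rewrite root_poly_q qE oppr_eq0 mulf_eq0 !subr_eq0 !inE.
- by move: r1_itv r2_itv r3_itv; lra.
- by move=> x; rewrite root_poly_r rE !mulf_eq0 !subr_eq0 !inE orbA.
- exact: spec.
- by move=> alpha a0; apply: spectral_cond_le (bounds _ a0) => //; exact: ltW.
- have lo : 8097%:R / 2000%:R < r3 / r2.
    by rewrite ltr_pdivlMr //; move: r2_itv r3_itv; lra.
  have hi : r3 / r2 < 8099%:R / 2000%:R.
    by rewrite ltr_pdivrMr //; move: r2_itv r3_itv; lra.
  by rewrite ltr_norml; move: (r3 / r2) lo hi => t; lra.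
(* Both [r2] and [r3] are positive roots of [r], so as eigenvalues they equal their moduli and
   attain both bounds. *)
- move=> kerK alpha a0; have modulus (r : R) : 0 <= r ->
      (1 - r) - r * (1 + r * (1 - r)) = 0 ->
      spectral_moduli (opB A M K alpha \o opA A M K alpha)%VF r.
    move=> r0 /(eigenvalue_of_ker A M_sa M_pd a0 kerK)[x x0 Ax].
    exists (real_complex R r); last by rewrite Re_norm_real ger0_norm.
    exact: (pencil_spectrum M_sa M_pd KR_pd K_psd a0 x0 Ax).
  apply: (spectral_cond_eq (bounds _ a0)); apply: modulus; rewrite ?ltW //.
    by rewrite rE subrr mulr0 mul0r.
  by rewrite rE subrr mulr0.
Qed.
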